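(* Let $\varphi\colon\Gamma\to G$ be a homomorphism of groups such that the normal closure $\langle\varphi(\Gamma)^G\rangle$ of $\varphi(\Gamma)$ in $G$ equals $G$. Let $\Gamma\xrightarrow{c_\varphi}\Gamma^\varphi\xrightarrow{\overline{\varphi}}G$ be the free normal closure of $\varphi$. Then the kernel of $\overline{\varphi}$ is (isomorphic to) the relative homology group $H_2(G,\Gamma)$ with respect to the map $\varphi$.
   Context: Notation: $h^g=g^{-1}hg$ in a group. A normal map (crossed module) is a group homomorphism $n\colon M\to G$ together with a right action of $G$ on $M$ by automorphisms, $(a,g)\mapsto a^g$ (the normal structure), such that (NM1) $n(a^g)=n(a)^g$ for all $a\in M$, $g\in G$; (NM2) $a^{n(b)}=a^b=b^{-1}ab$ for all $a,b\in M$. A normal morphism over $G$ from $n_1\colon M_1\to G$ to $n_2\colon M_2\to G$ is a homomorphism $\mu\colon M_1\to M_2$ with $n_2(\mu(a))=n_1(a)$ and $\mu(a^g)=\mu(a)^g$ for all $a\in M_1$, $g\in G$. The free normal closure of $\varphi\colon\Gamma\to G$ is a factorization $\Gamma\xrightarrow{c_\varphi}\Gamma^\varphi\xrightarrow{\overline\varphi}G$ of $\varphi$ (so $\overline\varphi(c_\varphi(\gamma))=\varphi(\gamma)$) with $\overline\varphi$ a normal map, such that for every factorization $\Gamma\xrightarrow{\psi}M\xrightarrow{n}G$ of $\varphi$ with $n$ a normal map there is a unique normal morphism $\overline\psi\colon\Gamma^\varphi\to M$ over $G$ with $\overline\psi(c_\varphi(\gamma))=\psi(\gamma)$ for all $\gamma\in\Gamma$.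 It exists and is unique up to isomorphism of normal maps over $G$. The relative homology group is $H_2(G,\Gamma)=H_2(BG\cup_{B\varphi}\mathrm{Cone}(B\Gamma);\mathbb{Z})$, the second integral homology of the mapping cone of the map of classifying spaces $B\varphi\colon B\Gamma\to BG$. *)

(* Defs.v *)
From HB Require Import structures.
From mathcomp Require Import freeg.
From mathcomp Require Import all_boot all_order all_algebra.
From mathcomp Require Import boolp classical_sets.

Set Implicit Arguments.
Unset Strict Implicit.
Unset Printing Implicit Defensive.

Import GRing.Theory.

Section Groups.
Local Open Scope group_scope.
Local Open Scope classical_set_scope.

Definition is_subgroup (G : groupType) (H : set G) : Prop :=
  H 1 /\ forall x y, H x -> H y -> H (x * y^-1).

Definition normal_closure (G : groupType) (A : set G) : set G :=
  smallest (@is_subgroup G) [set a ^ g | a in A & g in [set: G]].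

Record normal_map (G : groupType) : Type := NormalMap {
  nm_source :> groupType;
  nm_map : {multiplicative nm_source -> G};
  nm_act : nm_source -> G -> nm_source;
  nm_act1 : forall a, nm_act a 1 = a;
  nm_actM : forall a g h, nm_act a (g * h) = nm_act (nm_act a g) h;
  nm_act_mul : forall a b g, nm_act (a * b) g = nm_act a g * nm_act b g;
  nm_NM1 : forall a g, nm_map (nm_act a g) = nm_map a ^ g;
  nm_NM2 : forall a b, nm_act a (nm_map b) = a ^ b
}.

Definition is_normal_morphism (G : groupType) (M1 M2 : normal_map G)
    (mu : {multiplicative M1 -> M2}) : Prop :=
  (forall a, nm_map M2 (mu a) = nm_map M1 a) /\
  (forall a g, mu (nm_act a g) = nm_act (mu a) g).

Definition is_factorization (Gam G : groupType) (phi : {multiplicative Gam -> G})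
    (M : normal_map G) (psi : {multiplicative Gam -> M}) : Prop :=
  forall x, nm_map M (psi x) = phi x.

Definition is_free_normal_closure (Gam G : groupType)
    (phi : {multiplicative Gam -> G})
    (P : normal_map G) (c : {multiplicative Gam -> P}) : Prop :=
  is_factorization phi c /\
  forall (M : normal_map G) (psi : {multiplicative Gam -> M}),
    is_factorization phi psi ->
    exists mu : {multiplicative P -> M},
      [/\ is_normal_morphism mu, forall x, mu (c x) = psi x &
          forall mu' : {multiplicative P -> M},
            is_normal_morphism mu' -> (forall x, mu' (c x) = psi x) ->
            mu' =1 mu].

End Groups.

Section Kernel.
Local Open Scope group_scope.
Variables (G H : groupType) (f : {multiplicative G -> H}).

Definition ker_pred : pred G := [pred x | f x == 1].

Lemma ker_pred_closed : group_closed ker_pred.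
Proof.
have f1 : f 1 = 1 by apply: (@mulgI _ (f 1)); rewrite -gmulfM !mulg1.
split=> [|x y]; rewrite !inE ?f1 //.
move=> /eqP fx /eqP fy.
by apply/eqP/(@mulIg _ (f y)); rewrite -gmulfM mulgVK fx fy mulg1.
Qed.

Definition kernel : Type := {x : G | ker_pred x}.
HB.instance Definition _ := [isSub of kernel for @sval G ker_pred].
HB.instance Definition _ := [Choice of kernel by <:].
HB.instance Definition _ :=
  SubChoice_isSubGroup.Build G ker_pred kernel ker_pred_closed.

End Kernel.

(* A morphism [m] -> [n] of the simplex category, with [n] = {0 < ... < n}. *)
Record omap (m n : nat) : Type := OMap {
  omap_fun :> 'I_m.+1 -> 'I_n.+1;
  omap_mono : {homo omap_fun : i j / (i <= j)%N >-> (i <= j)%N}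
}.

Lemma id_mono n : {homo (@id 'I_n.+1) : i j / (i <= j)%N >-> (i <= j)%N}.
Proof. by []. Qed.
Definition omap_id n : omap n n := OMap (@id_mono n).

Lemma comp_mono l m n (b : omap m n) (a : omap l m) :
  {homo b \o a : i j / (i <= j)%N >-> (i <= j)%N}.
Proof. by move=> i j ij; apply/omap_mono/omap_mono. Qed.
Definition omap_comp l m n (b : omap m n) (a : omap l m) : omap l n :=
  OMap (comp_mono b a).

Lemma coface_mono n (i : 'I_n.+2) :
  {homo (fun j : 'I_n.+1 => lift i j) : j k / (j <= k)%N >-> (j <= k)%N}.
Proof. by move=> j k; rewrite leq_bump2. Qed.
Definition coface n (i : 'I_n.+2) : omap n n.+1 := OMap (coface_mono i).

Record sset : Type := SSet {
  simplex :> nat -> choiceType;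
  sact : forall m n, omap m n -> simplex n -> simplex m;
  sact_id : forall n (x : simplex n), sact (omap_id n) x = x;
  sact_comp : forall l m n (b : omap m n) (a : omap l m) (x : simplex n),
    sact (omap_comp b a) x = sact a (sact b x)
}.

Record smap (X Y : sset) : Type := SMap {
  smap_fun :> forall n, X n -> Y n;
  smap_nat : forall m n (a : omap m n) (x : X n),
    smap_fun (sact a x) = sact a (smap_fun x)
}.

Section Homology.
Local Open Scope ring_scope.
Variable X : sset.

Definition chain (n : nat) := {freeg (X n)}.

Definition boundary (n : nat) : chain n.+1 -> chain n :=
  fglift (fun x : X n.+1 =>
    \sum_(i < n.+2) (-1) ^+ i *: (<< sact (coface i) x >> : chain n)).

Definition cycle_pred (n : nat) : pred (chain n) :=
  match n return pred (chain n) with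
  | 0 => predT
  | n'.+1 => fun c => boundary c == 0
  end.

Lemma boundaryB n (c d : chain n.+1) :
  boundary (c - d) = boundary c - boundary d.
Proof. exact: lift_is_additive. Qed.

Lemma boundary0 n : boundary (0 : chain n.+1) = 0.
Proof. by rewrite -(subrr 0) boundaryB subrr. Qed.

Lemma cycle_closed n : zmod_closed (@cycle_pred n).
Proof.
case: n => [|n]; split=> //; first by rewrite unfold_in /= boundary0.
move=> c d; rewrite !unfold_in /= => /eqP c0 /eqP d0.
by rewrite boundaryB c0 d0 subrr.
Qed.
HB.instance Definition _ n :=
  GRing.isZmodClosed.Build (chain n) (@cycle_pred n) (cycle_closed n).

Definition cycles (n : nat) : Type := {c : chain n | @cycle_pred n c}.
HB.instance Definition _ n :=
  [isSub of cycles n for @sval (chain n) (@cycle_pred n)].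
HB.instance Definition _ n := [Choice of cycles n by <:].
HB.instance Definition _ n := [SubChoice_isSubZmodule of cycles n by <:].

Definition boundary_pred (n : nat) : pred (cycles n) :=
  fun z => `[< exists c : chain n.+1, boundary c = val z >].

Lemma boundary_closed n : zmod_closed (@boundary_pred n).
Proof.
split=> [|y z]; rewrite !unfold_in.
  by apply/asboolP; exists 0; rewrite boundary0 raddf0.
move=> /asboolP[c cy] /asboolP[d dz]; apply/asboolP; exists (c - d).
by rewrite boundaryB cy dz raddfB.
Qed.
HB.instance Definition _ n :=
  GRing.isZmodClosed.Build (cycles n) (@boundary_pred n) (boundary_closed n).

Definition boundaries (n : nat) : zmodClosed (cycles n) :=
  GRing.ZmodClosed.clone (cycles n) (@boundary_pred n) _.

Definition homology (n : nat) : zmodType := {ideal_quot (boundaries n)}.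

End Homology.

Section Nerve.
Local Open Scope group_scope.
Variable G : groupType.

(* The n-simplex (x_1, ..., x_n) is the functor from [n] to G that sends    *)
(* i <= j to x_(i+1) * ... * x_j; monotone maps act by precomposition.      *)
Definition nerve_act m n (a : omap m n) (x : n.-tuple G) : m.-tuple G :=
  [tuple \prod_(i < n | (a (widen_ord (leqnSn m) j) <= i < a (lift ord0 j))%N)
           tnth x i | j < m].

(* The value on i <= j, with x extended by 1. *)
Definition nerve_val n (x : n.-tuple G) (i j : nat) : G :=
  \prod_(i <= k < j) nth 1 x k.

Lemma nerve_actE m n (a : omap m n) (x : n.-tuple G) (j : 'I_m) :
  tnth (nerve_act a x) j =
  nerve_val x (a (widen_ord (leqnSn m) j)) (a (lift ord0 j)).
Proof.
rewrite tnth_mktuple /nerve_val.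
set p := nat_of_ord (a (widen_ord _ j)); set q := nat_of_ord (a (lift ord0 j)).
have qn : (q <= n)%N by rewrite -ltnS ltn_ord.
rewrite (@big_nat_widenl _ _ _ _ 0%N) // (big_nat_widen _ _ _ _ _ qn) big_mkord.
by apply: eq_big => [i|i _]; rewrite ?(tnth_nth 1) // andbC.
Qed.

Lemma nerve_val_cat n (x : n.-tuple G) (i j k : nat) : (i <= j <= k)%N ->
  nerve_val x i j * nerve_val x j k = nerve_val x i k.
Proof. by case/andP=> ij jk; rewrite /nerve_val (big_cat_nat ij jk). Qed.

Lemma nerve_val_act m n (a : omap m n) (x : n.-tuple G) (i j : 'I_m.+1) :
  (i <= j)%N -> nerve_val (nerve_act a x) i j = nerve_val x (a i) (a j).
Proof.
case: i => i im; case: j => j jm /= ij.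
elim: j jm ij => [|j IHj] jm ij.
  have i0 : i = 0 by apply/eqP; rewrite -leqn0.
  by subst i; rewrite (bool_irrelevance jm im) /nerve_val !big_geq.
move: ij; rewrite leq_eqVlt => /predU1P[ij|ij].
  by subst i; rewrite (bool_irrelevance jm im) /nerve_val !big_geq.
have jm' : (j < m.+1)%N by apply: ltnW.
have jm'' : (j < m)%N by [].
rewrite -(@nerve_val_cat _ (nerve_act a x) i j j.+1); last first.
  by rewrite leqnSn andbT.
rewrite (IHj jm' ij).
rewrite {2}/nerve_val big_nat1.
have -> : nth 1 (nerve_act a x) j = tnth (nerve_act a x) (Ordinal jm'').
  by rewrite (tnth_nth 1).
rewrite nerve_actE.
have -> : widen_ord (leqnSn m) (Ordinal jm'') = Ordinal jm' by apply: val_inj.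
have -> : lift ord0 (Ordinal jm'') = Ordinal jm by apply: val_inj.
by rewrite nerve_val_cat // !omap_mono /=.
Qed.

Lemma nerve_act_id n (x : n.-tuple G) : nerve_act (omap_id n) x = x.
Proof.
apply: eq_from_tnth => j; rewrite nerve_actE /= /nerve_val.
by rewrite /bump leq0n add1n big_nat1 (tnth_nth 1).
Qed.

Lemma nerve_act_comp l m n (b : omap m n) (a : omap l m) (x : n.-tuple G) :
  nerve_act (omap_comp b a) x = nerve_act a (nerve_act b x).
Proof.
apply: eq_from_tnth => j; rewrite !nerve_actE nerve_val_act //.
by apply: omap_mono; rewrite /= /bump leq0n add1n.
Qed.

(* BG, as a simplicial set: its geometric realization is the classifying    *)
(* space, whose singular homology is the simplicial homology of the nerve.  *)
Definition nerve : sset :=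
  @SSet (fun n => n.-tuple G : choiceType) nerve_act nerve_act_id nerve_act_comp.

End Nerve.

Section NerveMap.
Local Open Scope group_scope.
Variables (G H : groupType) (f : {multiplicative G -> H}).

Lemma nerve_map_nat m n (a : omap m n) (x : nerve G n) :
  map_tuple f (sact a x) = sact a (map_tuple f x : nerve H n) :> m.-tuple H.
Proof.
have f1 : f 1 = 1 by apply: (@mulgI _ (f 1)); rewrite -gmulfM !mulg1.
apply: eq_from_tnth => j; rewrite tnth_map !tnth_mktuple.
rewrite (big_morph f (@gmulfM _ _ f) f1).
by apply: eq_bigr => i _; rewrite tnth_map.
Qed.

Definition nerve_map : smap (nerve G) (nerve H) :=
  @SMap (nerve G) (nerve H) (fun n => map_tuple f) nerve_map_nat.

End NerveMap.

(* The mapping cone of f: Y with Cone(X) = (X x Delta^1) / (X x {1}) attached *)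
(* by gluing (x, 0) to f(x).  An n-simplex of Delta^1 is a monotone map        *)
(* [n] -> [1], determined by the number k <= n+1 of vertices sent to 0.  For   *)
(* k = n+1 the pair (x, k) is identified with f(x), and for k = 0 with the     *)
(* apex; the n-simplices of the cone are thus those of Y, the pairs (x, k)     *)
(* with 0 < k <= n (written (x, j) with k = j+1 and j : 'I_n), and the apex.   *)
Section MappingCone.
Variables (X Y : sset) (f : smap X Y).

Definition cone_simplex (n : nat) : choiceType := (Y n + (X n * 'I_n) + unit)%type.

Definition cone_base n (y : Y n) : cone_simplex n := inl (inl y).
Definition cone_mid n (x : X n) (j : 'I_n) : cone_simplex n := inl (inr (x, j)).
Definition cone_apex n : cone_simplex n := inr tt.

(* The class of (x, k), for k <= n+1. *)
Definition cone_class n (x : X n) (k : nat) : cone_simplex n :=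
  if k is j.+1 then
    if insub j is Some j' then cone_mid x j' else cone_base (f n x)
  else cone_apex n.

Definition cone_act m n (a : omap m n) (s : cone_simplex n) : cone_simplex m :=
  match s with
  | inl (inl y) => cone_base (sact a y)
  | inl (inr (x, j)) => cone_class (sact a x) #|[pred i | (a i <= j)%N]|
  | inr _ => cone_apex m
  end.

Lemma card_initial n (p : pred 'I_n) :
    (forall i j : 'I_n, (i <= j)%N -> p j -> p i) ->
  forall i : 'I_n, p i = (i < #|p|)%N.
Proof.
have card_lt k : (k <= n)%N -> #|[pred i : 'I_n | (i < k)%N]| = k.
  move=> kn; rewrite -sum1_card -(big_ord_widen n (fun _ => 1%N) kn).
  by rewrite sum1_card card_ord.
move=> p_init i; case: (boolP (p i)) => pi; apply/esym.
  rewrite -(card_lt i.+1) //; apply: subset_leq_card.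
  by apply/fintype.subsetP => j; rewrite inE ltnS => ji; apply: p_init pi.
apply/negbTE; rewrite -leqNgt -[X in (_ <= X)%N]card_lt; last exact: ltnW.
apply/subset_leq_card/fintype.subsetP => j pj; rewrite inE ltnNge.
by apply: contra pi => ij; apply: p_init pj.
Qed.

Lemma cone_act_id n (s : cone_simplex n) : cone_act (omap_id n) s = s.
Proof.
case: s => [[y|[x j]]|[]] //=; rewrite sact_id //.
have -> : #|[pred i : 'I_n.+1 | (i <= j)%N]| = j.+1.
  rewrite -sum1_card -(big_ord_widen n.+1 (fun _ => 1%N) (n1 := j.+1)).
    by rewrite sum1_card card_ord.
  by rewrite ltnS ltnW.
by rewrite /= valK.
Qed.

Lemma cone_act_comp l m n (b : omap m n) (a : omap l m) (s : cone_simplex n) :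
  cone_act (omap_comp b a) s = cone_act a (cone_act b s).
Proof.
case: s => [[y|[x j]]|[]] //=; rewrite sact_comp //.
set x' := sact b x; set k := #|[pred i | (b i <= j)%N]|.
have bk (i : 'I_m.+1) : (b i <= j)%N = (i < k)%N.
  apply: (@card_initial _ [pred i | (b i <= j)%N]) => i1 i2 i12 /=.
  by apply: leq_trans; apply: omap_mono.
have -> : #|[pred i | (b (a i) <= j)%N]| = #|[pred i | (a i < k)%N]|.
  by apply: eq_card => i; rewrite !inE bk.
have : (k <= m.+1)%N by rewrite -[X in (_ <= X)%N]card_ord max_card.
case: k {bk} => [|k] km.
  by rewrite (eq_card0 (A := [pred i | (a i < 0)%N])).
rewrite /cone_class; case: insubP => [k' _ kk'|] /=.
  by rewrite /cone_class -kk'.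
rewrite -leqNgt => mk; rewrite (eq_card (B := 'I_l.+1)) => [|i].
  by rewrite card_ord insubN ?ltnn // smap_nat.
by rewrite !inE; apply: leq_trans (ltn_ord _) _.
Qed.

Definition mapping_cone : sset := SSet cone_act_id cone_act_comp.

End MappingCone.

Definition relative_homology (Gam G : groupType)
    (phi : {multiplicative Gam -> G}) (n : nat) : zmodType :=
  homology (mapping_cone (nerve_map phi)) n.

(* Main.v *)
Require Import Defs.
From HB Require Import structures.
From mathcomp Require Import freeg.
From mathcomp Require Import all_boot all_order all_algebra.
From mathcomp Require Import boolp classical_sets.
From mathcomp Require Import zify.

(* By (NM2) the kernel K of P -> G is central, and P -> G is onto because     *)
(* phi(Gamma) normally generates G; so P is a central extension of G with a   *)
(* lift c of phi.  Let C_n be the chains of the mapping cone, Q = C_2 / B_2,  *)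
(* and b(g, h) in Q the class of the 2-simplex (g, h) of BG.  The boundaries  *)
(* of the 3-simplices of BG say that b is a 2-cocycle, so that                *)
(*    (p, g) (q, h) = (p + q - b(g, h), g h)                                  *)
(* defines a central extension E of G by Q, hence a normal map; the           *)
(* boundaries of the other 3-simplices of the cone provide a lift             *)
(* Gamma -> E of phi.  By the universal property there is a normal morphism   *)
(* mu : P -> E.  The function (q, g) |-> d q - [g] is a homomorphism E -> C_1 *)
(* vanishing on the lift of Gamma, and uniqueness forces it to vanish on      *)
(* mu(P); thus mu maps K to Z_2 / B_2.  Conversely, a section s of P -> G     *)
(* with its factor set, together with the difference between c and s o phi,   *)
(* is a 2-cocycle F : C_2 -> K of the cone; then (q, g) |-> F(q) s(g) is a    *)
(* homomorphism E -> P, inverse to mu on the left by uniqueness, while        *)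
(* mu (F u) = u - kappa (d u) for an explicit kappa : C_1 -> Q, so that F     *)
(* inverts mu on the right over the cycles.                                   *)

(** Both P and the twisted product E are central extensions of G equipped with a lift of phi. The
    kernel of E -> G is all of Q = C_2 / B_2, whereas H_2 is only Z_2 / B_2; the homomorphism
    [defect] measures the excess, and [defect_mu] shows that it vanishes on the image of P. The lift
    into E exists by [lift_coefM], and the map F from homology to the kernel is well defined by
    [cochain_boundary]. Injectivity of F comes from [mu_cochain], surjectivity from [defect_mu] and
    [mu_retraction]; the last two use uniqueness in the form [free_normal_closure_ext]. *)

Set Implicit Arguments.
Unset Strict Implicit.
Unset Printing Implicit Defensive.

Import GRing.Theory.

(** * Abelian groups *)

(* Reflexive tactic for identities valid in every Z-module: an expression is *)
(* determined by the integer coefficients of its atoms.                      *)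
Section ZmoduleReflection.
Local Open Scope ring_scope.

Inductive zmod_expr :=
  | ZVar of nat | ZZero | ZAdd of zmod_expr & zmod_expr | ZOpp of zmod_expr.

Variable V : zmodType.

Fixpoint zmod_eval (env : seq V) e : V :=
  match e with
  | ZVar n => nth 0 env n
  | ZZero => 0
  | ZAdd a b => zmod_eval env a + zmod_eval env b
  | ZOpp a => - zmod_eval env a
  end.

Fixpoint zmod_coef e (n : nat) : int :=
  match e with
  | ZVar m => (m == n)%:R
  | ZZero => 0
  | ZAdd a b => zmod_coef a n + zmod_coef b n
  | ZOpp a => - zmod_coef a n
  end.

Lemma zmod_evalE env e :
  zmod_eval env e = \sum_(i < size env) env`_i *~ zmod_coef e i.
Proof.
elim: e => [n||a IHa b IHb|a IHa] /=.
- have [n_lt|n_ge] := ltnP n (size env); last first.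
    rewrite nth_default // big1 // => i _.
    by rewrite gtn_eqF ?mulr0z // (leq_trans (ltn_ord i)).
  rewrite (bigD1 (Ordinal n_lt)) //= eqxx big1 ?addr0 // => i.
  by rewrite -val_eqE /= eq_sym => /negPf ->; rewrite mulr0z.
- by rewrite big1 // => i _; rewrite mulr0z.
- by rewrite IHa IHb -big_split; apply: eq_bigr => i _; rewrite mulrzDr.
- by rewrite IHa -sumrN; apply: eq_bigr => i _; rewrite mulrNz.
Qed.

Lemma zmod_eval_eq env a b :
  all (fun i => zmod_coef a i == zmod_coef b i) (iota 0 (size env)) ->
  zmod_eval env a = zmod_eval env b.
Proof.
move=> /allP ab; rewrite !zmod_evalE; apply: eq_bigr => i _.
by rewrite (eqP (ab i _)) ?mem_iota /=.
Qed.

End ZmoduleReflection.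

(** The dummy match on the goal lets [unify] run while a term is being built; atoms are thus
    compared up to conversion. *)
Ltac zmod_index x env :=
  match env with
  | ?y :: _ => let _ := match goal with _ => unify x y end in constr:(O)
  | _ :: ?env' => let n := zmod_index x env' in constr:(S n)
  end.

Ltac zmod_atoms t env :=
  match t with
  | GRing.add ?a ?b => let env' := zmod_atoms a env in zmod_atoms b env'
  | GRing.opp ?a => zmod_atoms a env
  | GRing.zero => env
  | _ => match goal with
         | _ => let _ := zmod_index t env in env
         | _ => constr:(t :: env)
         end
  end.

Ltac zmod_reify t env :=
  match t with
  | GRing.add ?a ?b =>
      let a' := zmod_reify a env in let b' := zmod_reify b env in
      constr:(ZAdd a' b')
  | GRing.opp ?a => let a' := zmod_reify a env in constr:(ZOpp a')
  | GRing.zero => constr:(ZZero)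
  | _ => let n := zmod_index t env in constr:(ZVar n)
  end.

Ltac zmod :=
  match goal with
  | |- @eq ?T ?l ?r =>
      let env := zmod_atoms l constr:(@nil T) in
      let env := zmod_atoms r env in
      let l' := zmod_reify l env in
      let r' := zmod_reify r env in
      apply: (@zmod_eval_eq _ env l' r'); vm_compute; reflexivity
  end.

Section FreeLift.
Local Open Scope ring_scope.
Variables (X : choiceType) (M : zmodType).

(** [zmodule M] is M seen as a module over the integers, as [fglift] requires. *)
Definition freeg_lift (f : X -> M) : {freeg X} -> M :=
  fglift (M := zmodule M) f.

Lemma freeg_lift_zmod_morphism f : zmod_morphism (freeg_lift f).
Proof. by have := @lift_is_additive int X (zmodule M) f. Qed.

HB.instance Definition _ f :=
  GRing.isZmodMorphism.Build {freeg X} M (freeg_lift f)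
    (freeg_lift_zmod_morphism f).

Lemma freeg_liftU f x : freeg_lift f << x >> = f x.
Proof. by rewrite /freeg_lift liftU scale1r. Qed.

End FreeLift.

Section Center.
Local Open Scope group_scope.
Variable G : groupType.

Definition center_pred : pred G := fun x => `[< forall y, commute x y >].
Definition center : Type := {x : G | center_pred x}.
HB.instance Definition _ := [isSub of center for @sval G center_pred].
HB.instance Definition _ := [Choice of center by <:].

Lemma center_comm (x : center) y : commute (val x) y.
Proof. exact: (asboolP _ (valP x)). Qed.

Lemma center_closed : group_closed center_pred.
Proof.
split=> [|x y]; first by apply/asboolP => y; exact: commute_sym (commute1 _).
move=> /asboolP xC /asboolP yC; apply/asboolP => z.
apply/commute_sym/commuteM; first exact/commute_sym.
by apply/commuteV/commute_sym.
Qed.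
HB.instance Definition _ :=
  SubChoice_isSubGroup.Build G center_pred center center_closed.

Lemma center_mulC : commutative (fun x y : center => x * y).
Proof. by move=> x y; apply: val_inj; rewrite !gmulfM; apply: center_comm. Qed.

(** The additive structure makes the center a target for homomorphisms from chains; [center_val]
    passes back to multiplicative notation. *)
HB.instance Definition _ := GRing.isZmodule.Build center
  (@mulgA center) center_mulC (@mul1g center) (@mulVg center).

Definition center_val (x : center) : G := val x.

Lemma center_val_inj : injective center_val.
Proof. exact: val_inj. Qed.

Lemma center_valC (x : center) y : center_val x * y = y * center_val x.
Proof. exact: center_comm. Qed.

Lemma center_valD (x y : center) :
  center_val (x + y)%R = center_val x * center_val y.
Proof. by []. Qed.

Lemma center_val0 : center_val 0%R = 1.
Proof. by []. Qed.

Lemma center_valN (x : center) : center_val (- x)%R = (center_val x)^-1.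
Proof. by []. Qed.

End Center.

Section FreegInduction.
Local Open Scope ring_scope.

(** Coefficients are integers, so the generators span under subtraction alone. *)
Lemma freeg_subgroup_ind (X : choiceType) (P : {freeg X} -> Prop) :
  P 0 -> (forall u v, P u -> P v -> P (u - v)) -> (forall x, P << x >>) ->
  forall u, P u.
Proof.
move=> P0 PB PU; have PN u : P u -> P (- u) by rewrite -sub0r; apply: PB.
have PD u v : P u -> P v -> P (u + v).
  by move=> Pu /PN Pv; rewrite -[v]opprK; apply: PB.
have Pn u n : P u -> P (u *+ n).
  by move=> Pu; elim: n => [|n IH]; rewrite ?mulr0n ?mulrS //; apply: PD.
elim/freeg_ind_dom0 => [//|k x D _ _ PD']; apply: PD => //.
rewrite -[k]intz -freegU_mulz.
by case: (intP k) => [|n|n]; rewrite ?mulr0z ?mulrNz -?pmulrn //;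
  do ?apply: PN; apply: Pn.
Qed.

End FreegInduction.

Section IdealQuotient.
Local Open Scope ring_scope.
Local Open Scope quotient_scope.
Variables (R : zmodType) (I : zmodClosed R).

Lemma ideal_quot_eq x y :
  (\pi_{ideal_quot I} x == \pi_{ideal_quot I} y) = (x - y \in I).
Proof. by rewrite Quotient.idealrBE. Qed.

Lemma ideal_quot_repr x : repr (\pi_{ideal_quot I} x) - x \in I.
Proof. by rewrite -ideal_quot_eq reprK. Qed.

End IdealQuotient.

Section Cokernel.
Local Open Scope ring_scope.
Local Open Scope quotient_scope.
Variables (A B : zmodType) (d : {additive A -> B}).

Definition image_pred : pred B := fun b => `[< exists a, d a = b >].

Lemma image_closed : zmod_closed image_pred.
Proof.
split=> [|_ _ /asboolP[a <-] /asboolP[b <-]]; apply/asboolP.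
  by exists 0; rewrite raddf0.
by exists (a - b); rewrite raddfB.
Qed.
HB.instance Definition _ := GRing.isZmodClosed.Build B image_pred image_closed.

Definition coker : zmodType :=
  {ideal_quot (GRing.ZmodClosed.clone B image_pred _)}.
Definition to_coker (b : B) : coker := \pi_coker b.

Lemma to_coker_zmod_morphism : zmod_morphism to_coker.
Proof. exact: (raddfB (\pi_coker)). Qed.
HB.instance Definition _ :=
  GRing.isZmodMorphism.Build B coker to_coker to_coker_zmod_morphism.

Lemma to_coker_surj q : exists b, to_coker b = q.
Proof. by exists (repr q); apply: reprK. Qed.

Lemma to_coker_eq0 b : to_coker b = 0 <-> exists a, d a = b.
Proof.
rewrite -(raddf0 to_coker); split=> [/eqP|[a ab]].
  by rewrite ideal_quot_eq subr0 => /asboolP.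
by apply/eqP; rewrite ideal_quot_eq subr0; apply/asboolP; exists a.
Qed.

Variables (M : zmodType) (F : {additive B -> M}).
Hypothesis Fd : forall a, F (d a) = 0.

Definition coker_lift (q : coker) : M := F (repr q).

Lemma coker_liftE b : coker_lift (to_coker b) = F b.
Proof.
apply/eqP; rewrite -subr_eq0 -raddfB.
have /asboolP[a <-] :=
  ideal_quot_repr (GRing.ZmodClosed.clone B image_pred _) b.
by rewrite Fd.
Qed.

Lemma coker_liftB : zmod_morphism coker_lift.
Proof.
move=> p q; have [a <-] := to_coker_surj p; have [b <-] := to_coker_surj q.
by rewrite -raddfB !coker_liftE raddfB.
Qed.

End Cokernel.

(** * Central extensions from cocycles *)

Section GroupMorphisms.
Local Open Scope group_scope.
Variables (G H : groupType) (f : {multiplicative G -> H}).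

Lemma group_morph1 : f 1 = 1.
Proof. by apply: (@mulgI _ (f 1)); rewrite -gmulfM !mulg1. Qed.

Lemma group_morphV x : f x^-1 = (f x)^-1.
Proof. by apply/esym/mulg1_eq; rewrite -gmulfM mulgV group_morph1. Qed.

Lemma group_morphJ x y : f (x ^ y) = f x ^ f y.
Proof. by rewrite !conjgE !gmulfM group_morphV. Qed.

End GroupMorphisms.

Record cocycle (G : groupType) (Q : zmodType) := Cocycle {
  cocycle_fun :> G -> G -> Q;
  cocycleP : forall g h k : G,
    (cocycle_fun h k + cocycle_fun g (h * k)%g =
     cocycle_fun (g * h)%g k + cocycle_fun g h)%R
}.

(** The cocycle is kept in the type so that the group structure can be inferred from it. *)
Definition twisted_product (G : groupType) (Q : zmodType) (alpha : cocycle G Q)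
  : Type := (Q * G)%type.

Section TwistedProduct.
Local Open Scope group_scope.
Variables (G : groupType) (Q : zmodType) (alpha : cocycle G Q).

Lemma cocycle1g g : alpha 1 g = alpha 1 1.
Proof. by have := cocycleP alpha 1 1 g; rewrite !mul1g => /addrI. Qed.

Lemma cocycleg1 g : alpha g 1 = alpha 1 1.
Proof. by have := cocycleP alpha g 1 1; rewrite !mulg1 => /addIr. Qed.

Lemma cocyclegV g : alpha g g^-1 = alpha g^-1 g.
Proof.
have := cocycleP alpha g g^-1 g.
by rewrite mulgV mulVg cocycle1g cocycleg1 addrC => /addrI.
Qed.

Local Notation E := (twisted_product alpha).
HB.instance Definition _ := Choice.on E.

(** Cocycles are not assumed normalized, hence the correction [alpha 1 1]. *)
Definition twisted_one : E := (alpha 1 1, 1).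
Definition twisted_mul (x y : E) : E :=
  ((x.1 + y.1 - alpha x.2 y.2)%R, x.2 * y.2).
Definition twisted_inv (x : E) : E :=
  ((- x.1 + alpha x.2 x.2^-1%g + alpha 1%g 1%g)%R, x.2^-1).

Lemma twisted_mulA : associative twisted_mul.
Proof.
move=> [p g] [q h] [r k]; rewrite /twisted_mul /= mulgA; congr pair.
apply/eqP; rewrite -subr_eq0.
have /eqP := cocycleP alpha g h k; rewrite -subr_eq0 -oppr_eq0 => /eqP <-.
apply/eqP; zmod.
Qed.

Lemma twisted_mul1g : left_id twisted_one twisted_mul.
Proof.
by move=> [p g]; rewrite /twisted_mul /= mul1g cocycle1g addrC addKr.
Qed.

Lemma twisted_mulg1 : right_id twisted_one twisted_mul.
Proof. by move=> [p g]; rewrite /twisted_mul /= mulg1 cocycleg1 addrK. Qed.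

Lemma twisted_mulVg : left_inverse twisted_one twisted_inv twisted_mul.
Proof.
move=> [p g]; rewrite /twisted_mul /= mulVg cocyclegV; congr pair; zmod.
Qed.

Lemma twisted_mulgV : right_inverse twisted_one twisted_inv twisted_mul.
Proof.
move=> [p g]; rewrite /twisted_mul /= mulgV; congr pair; zmod.
Qed.

HB.instance Definition _ := isGroup.Build E
  twisted_mulA twisted_mul1g twisted_mulg1 twisted_mulVg twisted_mulgV.

Definition twisted_proj (x : E) : G := x.2.

Lemma twisted_projM : {morph twisted_proj : x y / x * y}.
Proof. by []. Qed.
HB.instance Definition _ :=
  isMultiplicative.Build E G twisted_proj twisted_projM.

(* x and y differ by an element over 1, and those are central. *)
Lemma twisted_conj_fiber (a x y : E) : x.2 = y.2 -> a ^ x = a ^ y.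
Proof.
move=> xy; have -> : x = y * (y^-1 * x) by rewrite mulVKg.
have: (y^-1 * x).2 = 1 by rewrite /= xy mulVg.
rewrite conjgM; move: (y^-1 * x) => z z1.
apply: (mulgI z); rewrite -conjgC.
congr pair; rewrite /= z1 ?mulg1 ?mul1g // cocycle1g cocycleg1.
by congr (_ + _)%R; rewrite addrC.
Qed.

(** The choice of (0, g) over g is not multiplicative, but by [twisted_conj_fiber] any lift of g
    conjugates in the same way; this yields the action laws and (NM2). *)
Definition twisted_act (a : E) (g : G) : E := a ^ ((0%R, g) : E).

Definition twisted_normal_map : normal_map G.
Proof.
exists E twisted_proj twisted_act.
- by move=> a; rewrite -[RHS]conjg1; apply: twisted_conj_fiber.
- by move=> a g h; rewrite /twisted_act -conjgM; apply: twisted_conj_fiber.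
- by move=> a b g; apply: conjMg.
- by move=> a g; rewrite group_morphJ.
- by move=> a b; apply: twisted_conj_fiber.
Defined.

End TwistedProduct.

(** * Faces and boundaries in the mapping cone *)

Section NerveFaces.
Local Open Scope group_scope.
Variable G : groupType.

Lemma nerve_face3 (x y z : G) (i : 'I_4) :
  sact (coface i) ([tuple x; y; z] : nerve G 3) =
  tnth [tuple [tuple y; z]; [tuple x * y; z]; [tuple x; y * z]; [tuple x; y]] i.
Proof.
by apply: eq_from_tnth => j; rewrite [LHS]nerve_actE /nerve_val unlock;
  case: i => -[|[|[|[|[]]]]] //= ?; case: j => -[|[|[]]] //= ?;
  rewrite ?mulg1.
Qed.

Lemma nerve_face2 (x y : G) (i : 'I_3) :
  sact (coface i) ([tuple x; y] : nerve G 2) =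
  tnth [tuple [tuple y]; [tuple x * y]; [tuple x]] i.
Proof.
by apply: eq_from_tnth => j; rewrite [LHS]nerve_actE /nerve_val unlock;
  case: i => -[|[|[|[]]]] //= ?; case: j => -[|[]] //= ?;
  rewrite ?mulg1.
Qed.

End NerveFaces.

Section ConeFaces.
Variables (X Y : sset) (f : smap X Y).

Lemma cone_class_mid n (x : X n) (j : 'I_n) :
  cone_class f x j.+1 = cone_mid Y x j.
Proof. by rewrite /cone_class valK. Qed.

Lemma cone_class_base n (x : X n) :
  cone_class f x n.+1 = cone_base X (f n x).
Proof. by rewrite /cone_class insubN ?ltnn. Qed.

Lemma cone_base_act m n (a : Defs.omap m n) (y : Y n) :
  sact a (cone_base X y : mapping_cone f n) = cone_base X (sact a y).
Proof. by []. Qed.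

(** The vertices 0, ..., j lie in the base. Deleting vertex i leaves j of them if i <= j, and j + 1
    otherwise. *)
Lemma cone_mid_face n (i : 'I_n.+2) (x : X n.+1) (j : 'I_n.+1) :
  sact (coface i) (cone_mid Y x j : mapping_cone f n.+1) =
  cone_class f (sact (coface i) x) (j + (j < i)).
Proof.
rewrite /=; congr cone_class.
have le_n : (j + (j < i) <= n.+1)%N.
  by case: ltnP => _; rewrite ?addn0 ?addn1 // ltnW.
rewrite -sum1_card (eq_bigl (fun k : 'I_n.+1 => (k < j + (j < i))%N)).
  by rewrite -(big_ord_widen n.+1 (fun _ => 1%N) le_n) sum1_card card_ord.
move=> k; rewrite !inE /= /bump.
by case: (ltnP j i) => ji; case: (leqP i k) => ik /=; lia.
Qed.

End ConeFaces.

Lemma ordinal2P (P : 'I_2 -> Prop) :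
  P ord0 -> P (lift ord0 ord0) -> forall j, P j.
Proof.
move=> P0 P1 [[|[|//]] j].
  by rewrite (_ : Ordinal j = ord0) //; apply: val_inj.
by rewrite (_ : Ordinal j = lift ord0 ord0) //; apply: val_inj.
Qed.

Lemma ordinal3P (P : 'I_3 -> Prop) :
  P ord0 -> P (lift ord0 ord0) -> P (lift ord0 (lift ord0 ord0)) ->
  forall j, P j.
Proof.
move=> P0 P1 P2 [[|[|[|//]]] j].
- by rewrite (_ : Ordinal j = ord0) //; apply: val_inj.
- by rewrite (_ : Ordinal j = lift ord0 ord0) //; apply: val_inj.
by rewrite (_ : Ordinal j = lift ord0 (lift ord0 ord0)) //; apply: val_inj.
Qed.

Section RelativeChains.
Local Open Scope ring_scope.
Variables (Gam G : groupType) (phi : {multiplicative Gam -> G}).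
Local Notation C := (mapping_cone (nerve_map phi)).

Lemma boundaryU (X : sset) n (x : X n.+1) :
  boundary << x >> = \sum_(i < n.+2) (-1) ^+ i *: << sact (coface i) x >>.
Proof. by rewrite /boundary liftU scale1r. Qed.

Definition base1 (g : G) : C 1 := cone_base (nerve Gam) ([tuple g] : nerve G 1).
Definition base2 (g h : G) : C 2 :=
  cone_base (nerve Gam) ([tuple g; h] : nerve G 2).
Definition base3 (g h k : G) : C 3 :=
  cone_base (nerve Gam) ([tuple g; h; k] : nerve G 3).
Definition mid1 (x : Gam) : C 1 :=
  cone_mid (nerve G) ([tuple x] : nerve Gam 1) ord0.
(* The first j + 1 vertices of mid2 j x y and of mid3 j x y z lie in the base *)
(* X x {0} of the cone, the others at the apex.                              *)
Definition mid2 (j : 'I_2) (x y : Gam) : C 2 :=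
  cone_mid (nerve G) ([tuple x; y] : nerve Gam 2) j.
Definition mid3 (j : 'I_3) (x y z : Gam) : C 3 :=
  cone_mid (nerve G) ([tuple x; y; z] : nerve Gam 3) j.
Definition apex n : C n := cone_apex (nerve Gam) (nerve G) n.

Local Notation low := (ord0 : 'I_2).
Local Notation high := (lift ord0 ord0 : 'I_2).

Lemma boundaryU2 (X : sset) (x : X 2) :
  boundary << x >> = << sact (coface ord0) x >> -
    << sact (coface (lift ord0 ord0)) x >> + << sact (coface ord_max) x >>.
Proof.
rewrite boundaryU !big_ord_recl big_ord0 /= expr0 expr1 sqrrN expr1n.
rewrite scale1r scaleN1r scale1r addr0 addrA.
by congr (_ - _ + << sact (coface _) _ >>); apply: val_inj.
Qed.

Lemma boundaryU3 (X : sset) (x : X 3) :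
  boundary << x >> = << sact (coface ord0) x >> -
    << sact (coface (lift ord0 ord0)) x >> +
    << sact (coface (lift ord0 (lift ord0 ord0))) x >> -
    << sact (coface ord_max) x >>.
Proof.
rewrite boundaryU !big_ord_recl big_ord0 /= expr0 expr1 sqrrN expr1n.
rewrite exprSr sqrrN expr1n mul1r.
rewrite !scale1r !scaleN1r addr0 !addrA.
by congr (_ - _ + _ - << sact (coface _) _ >>); apply: val_inj.
Qed.

Lemma boundary_base2 g h : boundary << base2 g h >> =
  << base1 h >> - << base1 (g * h)%g >> + << base1 g >>.
Proof.
by rewrite boundaryU2 !cone_base_act !nerve_face2 !(tnth_nth [tuple 1%g]).
Qed.

Lemma boundary_base3 g h k : boundary << base3 g h k >> =
  << base2 h k >> - << base2 (g * h)%g k >> +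
  << base2 g (h * k)%g >> - << base2 g h >>.
Proof.
by rewrite boundaryU3 !cone_base_act !nerve_face3 !(tnth_nth [tuple 1%g; 1%g]).
Qed.

Lemma boundary_apex2 : boundary << apex 2 >> = << apex 1 >>.
Proof. by rewrite boundaryU2 /= subrr add0r. Qed.

Lemma boundary_apex3 : boundary << apex 3 >> = 0.
Proof. by rewrite boundaryU3 /= subrr add0r subrr. Qed.

Lemma cone_class1 (x : Gam) : 
  cone_class (nerve_map phi) ([tuple x] : nerve Gam 1) 1 = mid1 x.
Proof. exact: (cone_class_mid _ _ ord0). Qed.

Lemma cone_class2 (x : Gam) : 
  cone_class (nerve_map phi) ([tuple x] : nerve Gam 1) 2 = base1 (phi x).
Proof. by rewrite cone_class_base; congr inl; congr inl; apply: val_inj. Qed.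

Lemma boundary_low x y : boundary << mid2 low x y >> =
  << apex 1 >> - << mid1 (x * y)%g >> + << mid1 x >>.
Proof.
rewrite boundaryU2 !cone_mid_face !nerve_face2 !(tnth_nth [tuple 1%g]).
by rewrite -!cone_class1.
Qed.

Lemma boundary_high x y : boundary << mid2 high x y >> =
  << mid1 y >> - << mid1 (x * y)%g >> + << base1 (phi x) >>.
Proof.
rewrite boundaryU2 !cone_mid_face !nerve_face2 !(tnth_nth [tuple 1%g]).
by rewrite -!cone_class1 -cone_class2.
Qed.

Lemma cone_class2_low (x y : Gam) : 
  cone_class (nerve_map phi) ([tuple x; y] : nerve Gam 2) 1 = mid2 low x y.
Proof. exact: (cone_class_mid _ _ low). Qed.

Lemma cone_class2_high (x y : Gam) : 
  cone_class (nerve_map phi) ([tuple x; y] : nerve Gam 2) 2 = mid2 high x y.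
Proof. exact: (cone_class_mid _ _ high). Qed.

Lemma cone_class2_base (x y : Gam) : 
  cone_class (nerve_map phi) ([tuple x; y] : nerve Gam 2) 3 =
  base2 (phi x) (phi y).
Proof. by rewrite cone_class_base; congr inl; congr inl; apply: val_inj. Qed.

Lemma boundary_mid3_0 x y z : boundary << mid3 ord0 x y z >> =
  << apex 2 >> - << mid2 low (x * y)%g z >> + << mid2 low x (y * z)%g >>
  - << mid2 low x y >>.
Proof.
rewrite boundaryU3 !cone_mid_face !nerve_face3 !(tnth_nth [tuple 1%g; 1%g]).
by rewrite -!cone_class2_low.
Qed.

Lemma boundary_mid3_1 x y z : boundary << mid3 (lift ord0 ord0) x y z >> =
  << mid2 low y z >> - << mid2 low (x * y)%g z >> + << mid2 high x (y * z)%g >>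
  - << mid2 high x y >>.
Proof.
rewrite boundaryU3 !cone_mid_face !nerve_face3 !(tnth_nth [tuple 1%g; 1%g]).
by rewrite -!cone_class2_low -!cone_class2_high.
Qed.

Lemma boundary_mid3_2 x y z :
    boundary << mid3 (lift ord0 (lift ord0 ord0)) x y z >> =
  << mid2 high y z >> - << mid2 high (x * y)%g z >>
  + << mid2 high x (y * z)%g >> - << base2 (phi x) (phi y) >>.
Proof.
rewrite boundaryU3 !cone_mid_face !nerve_face3 !(tnth_nth [tuple 1%g; 1%g]).
by rewrite -!cone_class2_high -cone_class2_base.
Qed.

Lemma simplex2P (P : C 2 -> Prop) : (forall g h, P (base2 g h)) ->
  (forall j x y, P (mid2 j x y)) -> P (apex 2) -> forall s, P s.
Proof.
move=> Pb Pm Pa [[y|[x j]]|[]] //.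
  by case/tupleP: y => g; case/tupleP => h y; rewrite tuple0; apply: Pb.
by case/tupleP: x => g; case/tupleP => h y; rewrite tuple0; apply: Pm.
Qed.

Lemma simplex3P (P : C 3 -> Prop) : (forall g h k, P (base3 g h k)) ->
  (forall j x y z, P (mid3 j x y z)) -> P (apex 3) -> forall s, P s.
Proof.
move=> Pb Pm Pa [[y|[x j]]|[]] //.
  case/tupleP: y => g; case/tupleP => h; case/tupleP => k y.
  by rewrite tuple0; apply: Pb.
case/tupleP: x => g; case/tupleP => h; case/tupleP => k y.
by rewrite tuple0; apply: Pm.
Qed.

End RelativeChains.

(** * The extension of G by chains modulo boundaries *)

HB.instance Definition _ (X : sset) n :=
  GRing.isZmodMorphism.Build (chain X n.+1) (chain X n) (@boundary X n)
    (@boundaryB X n).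

Section UniversalExtension.
Local Open Scope ring_scope.
Variables (Gam G : groupType) (phi : {multiplicative Gam -> G}).
Local Notation C := (mapping_cone (nerve_map phi)).
Local Notation b1 := (@base1 Gam G phi).
Local Notation b2 := (@base2 Gam G phi).
Local Notation low := (@mid2 Gam G phi ord0).
Local Notation high := (@mid2 Gam G phi (lift ord0 ord0)).
Local Notation apex n := (@apex Gam G phi n).

Definition chain2_quot : zmodType := coker (@boundary C 2).
Local Notation Q := chain2_quot.
Definition simplex_class (x : C 2) : Q := to_coker (@boundary C 2) << x >>.
Local Notation "[ x ]" := (simplex_class x).

Lemma simplex_classE x : to_coker (@boundary C 2) << x >> = [x].
Proof. by []. Qed.

Lemma to_coker_boundary u : to_coker (@boundary C 2) (boundary u) = 0 :> Q.
Proof. by apply/to_coker_eq0; exists u. Qed.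

Lemma eq_of_rel (V : zmodType) (r x y : V) : r = 0 -> x - y = r -> x = y.
Proof. by move=> -> /eqP; rewrite subr_eq0 => /eqP. Qed.

Lemma base_rel g h k :
  [b2 h k] + [b2 g (h * k)%g] = [b2 (g * h)%g k] + [b2 g h].
Proof.
apply: eq_of_rel (to_coker_boundary << base3 phi g h k >>) _.
rewrite boundary_base3 !(raddfB, raddfD) /= !simplex_classE; zmod.
Qed.

Definition base_cocycle := @Cocycle G Q (fun g h => [b2 g h]) base_rel.
Local Notation E := (twisted_product base_cocycle).

Lemma base1_rel g : [b2 1%g g] = [b2 1%g 1%g].
Proof. exact: (cocycle1g base_cocycle). Qed.

(** A first edge equal to 1 in the cocycle relation reduces the two-variable classes to the
    one-variable function x |-> [low 1 x]. *)
Lemma low_rel x y :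
  [low x y] = [apex 2] + [low 1%g (x * y)%g] - [low 1%g x].
Proof.
apply/esym.
apply: eq_of_rel (to_coker_boundary << mid3 phi ord0 1 x y >>) _.
rewrite boundary_mid3_0 mul1g !(raddfB, raddfD) /= !simplex_classE; zmod.
Qed.

(** The part of [high x y] that depends on x alone. Its boundary is the edge of phi x, whence
    [defect_lift]. *)
Definition lift_coef x := [high x 1%g] + [apex 2] - [low 1%g x].

Lemma high_rel x y :
  [high x y] = lift_coef x + [low 1%g (x * y)%g] - [low 1%g y].
Proof.
apply: eq_of_rel (to_coker_boundary << mid3 phi (lift ord0 ord0) x 1 y >>) _.
rewrite boundary_mid3_1 mul1g mulg1 !(raddfB, raddfD) /= !simplex_classE.
rewrite (low_rel x y) /lift_coef; zmod.
Qed.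

(** In the boundary of the third kind of middle simplex, rewritten by [high_rel], all terms
    [low 1 _] cancel. *)
Lemma lift_coefM x y :
  lift_coef (x * y)%g = lift_coef x + lift_coef y - [b2 (phi x) (phi y)].
Proof.
have := to_coker_boundary << mid3 phi (lift ord0 (lift ord0 ord0)) x y 1 >>.
rewrite boundary_mid3_2 mulg1 !(raddfN, raddfB, raddfD) /= !simplex_classE.
rewrite !high_rel !mulg1 => rel.
apply/esym; apply: eq_of_rel rel _; zmod.
Qed.

Definition relative_lift (x : Gam) : E := (lift_coef x, phi x).

Lemma relative_liftM : {morph relative_lift : x y / (x * y)%g}.
Proof. by move=> x y; rewrite /relative_lift lift_coefM gmulfM. Qed.
HB.instance Definition _ :=
  isMultiplicative.Build Gam E relative_lift relative_liftM.

Lemma boundary_boundary (u : chain C 3) : boundary (boundary u) = 0.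
Proof.
move: u; apply: freeg_subgroup_ind => [|u v u0 v0|].
- by rewrite !raddf0.
- by rewrite !raddfB /= u0 v0 subrr.
apply: simplex3P => [g h k||].
- rewrite (boundary_base3 phi) !(raddfB, raddfD) /= !(boundary_base2 phi).
  rewrite mulgA; zmod.
- apply: ordinal3P => x y z.
  + rewrite (boundary_mid3_0 phi) !(raddfB, raddfD) /= !(boundary_low phi).
    rewrite (boundary_apex2 phi) mulgA; zmod.
  + rewrite (boundary_mid3_1 phi) !(raddfB, raddfD) /= !(boundary_low phi).
    rewrite !(boundary_high phi) mulgA; zmod.
  + rewrite (boundary_mid3_2 phi) !(raddfB, raddfD) /= !(boundary_high phi).
    rewrite (boundary_base2 phi) mulgA gmulfM; zmod.
- by rewrite (boundary_apex3 phi) raddf0.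
Qed.

Definition quot_boundary : Q -> chain C 1 := coker_lift (@boundary C 1).
Definition defect (e : E) : chain C 1 := quot_boundary e.1 - << b1 e.2 >>.

Lemma quot_boundaryE u :
  quot_boundary (to_coker (@boundary C 2) u) = boundary u.
Proof. exact: coker_liftE boundary_boundary u. Qed.

HB.instance Definition _ := GRing.isZmodMorphism.Build Q (chain C 1)
  quot_boundary (coker_liftB boundary_boundary).

(** The boundary [h] - [g h] + [g] of b(g, h) is exactly the failure of g |-> [g] to be additive. *)
Lemma defectM (e e' : E) : defect (e * e')%g = defect e + defect e'.
Proof.
rewrite /defect /= !(raddfB, raddfD) /= quot_boundaryE.
rewrite (boundary_base2 phi); zmod.
Qed.

Lemma defect_lift x : defect (relative_lift x) = 0.
Proof.
rewrite /defect /= !(raddfB, raddfD) /= !quot_boundaryE.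
rewrite (boundary_high phi) (boundary_low phi) (boundary_apex2 phi).
rewrite mulg1 mul1g; zmod.
Qed.

End UniversalExtension.

(** * Comparison with the free normal closure *)

Section NormalMaps.
Local Open Scope group_scope.
Variables (G : groupType) (M : normal_map G).

Lemma nm_ker_comm (a b : M) : nm_map M a = 1 -> commute a b.
Proof.
move=> a1; apply/commute_sym/commgP/conjg_fixP.
by rewrite -nm_NM2 a1 nm_act1.
Qed.

(** By (NM1) the image of a normal map is stable under conjugation, and it contains the image of
    phi. *)
Lemma nm_surjective (Gam : groupType) (phi : {multiplicative Gam -> G})
    (psi : {multiplicative Gam -> M}) :
  is_factorization phi psi -> normal_closure (range phi) = [set: G]%classic ->
  forall g, exists a, nm_map M a = g.
Proof.
move=> psiP phiG g.
suff /(_ g)[|a _ ag] :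
  (normal_closure (range phi) `<=` range (nm_map M))%classic.
- by rewrite phiG.
- by exists a.
apply: smallest_sub.
  split=> [|_ _ [a _ <-] [b _ <-]]; first by exists 1; rewrite ?group_morph1.
  by exists (a * b^-1); rewrite // gmulfM group_morphV.
move=> _ [_ [x _ <-] [h _ <-]].
by exists (nm_act (psi x) h); rewrite // nm_NM1 psiP.
Qed.

End NormalMaps.

(** Both morphisms solve the universal problem for the factorization through [mu \o c]. *)
Lemma free_normal_closure_ext (Gam G : groupType)
    (phi : {multiplicative Gam -> G}) (P : normal_map G)
    (c : {multiplicative Gam -> P}) (M : normal_map G)
    (mu nu : {multiplicative P -> M}) :
    is_free_normal_closure phi c -> is_normal_morphism mu ->
    is_normal_morphism nu -> (forall x, mu (c x) = nu (c x)) -> mu =1 nu.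
Proof.
move=> [cP univ] mu_n nu_n mu_nu a.
have facP : is_factorization phi (mu \o c : {multiplicative Gam -> M}).
  by move=> x; rewrite /= mu_n.1 cP.
have [rho [_ _ rho_unique]] := univ M _ facP.
by rewrite (rho_unique mu) // (rho_unique nu) // => x; rewrite -mu_nu.
Qed.

Section Comparison.
Variables (Gam G : groupType) (phi : {multiplicative Gam -> G}).
Variables (P : normal_map G) (c : {multiplicative Gam -> P}).
Hypothesis cP : is_factorization phi c.
Variable s : G -> P.
Hypothesis sK : cancel s (nm_map P).

Local Notation C := (mapping_cone (nerve_map phi)).
Local Notation b1 := (@base1 Gam G phi).
Local Notation b2 := (@base2 Gam G phi).
Local Notation low := (@mid2 Gam G phi ord0).
Local Notation high := (@mid2 Gam G phi (lift ord0 ord0)).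
Local Notation Q := (chain2_quot phi).
Local Notation E := (twisted_product (base_cocycle phi)).

(** * The 2-cocycle of the cone defined by a section *)

Section Cochain.
Local Open Scope group_scope.

(* The factor set of s on the base, and the discrepancy between c and s o phi *)
(* on the simplices with exactly two vertices in the base.                    *)
Definition cochain_val (x : C 2) : P :=
  match x with
  | inl (inl t) => let g := tnth t ord0 in let h := tnth t ord_max in
                   s (g * h) * (s h)^-1 * (s g)^-1
  | inl (inr (t, j)) => let x := tnth t ord0 in
                        if j == ord0 then 1 else c x * (s (phi x))^-1
  | inr _ => 1
  end.

Lemma cochain_val_ker x : nm_map P (cochain_val x) = 1.
Proof.
elim/(@simplex2P Gam G phi): x => [g h|j x y|] /=; last exact: group_morph1.
  by rewrite !gmulfM !group_morphV !sK mulgK mulgV.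
by case: eqP => _; rewrite ?group_morph1 // gmulfM group_morphV sK cP mulgV.
Qed.

Lemma ker_center (a : P) : nm_map P a = 1 -> center_pred a.
Proof. by move=> a1; apply/asboolP => b; apply: nm_ker_comm. Qed.

Definition cochain_gen (x : C 2) : center P :=
  Sub (cochain_val x) (ker_center (cochain_val_ker x)).

Definition cochain : chain C 2 -> center P := freeg_lift cochain_gen.
HB.instance Definition _ :=
  GRing.Additive.copy cochain (freeg_lift cochain_gen).

Local Notation F u := (center_val (cochain u)).

Lemma cochainU x : F << x >> = cochain_val x.
Proof. by rewrite /cochain freeg_liftU. Qed.

Lemma cochain_ker u : nm_map P (F u) = 1.
Proof.
move: u; apply: freeg_subgroup_ind => [|u v u1 v1|x].
- by rewrite raddf0 center_val0 group_morph1.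
- by rewrite raddfB center_valD center_valN gmulfM group_morphV u1 v1 mulgV.
- by rewrite cochainU cochain_val_ker.
Qed.

Lemma cochain_base g h : F << b2 g h >> * (s g * s h) = s (g * h).
Proof. by rewrite cochainU /= /tnth /= mulgA !mulgVK. Qed.

Lemma cochain_high x y : F << high x y >> * s (phi x) = c x.
Proof. by rewrite cochainU /= /tnth /= mulgVK. Qed.

Lemma cochain_low x y : cochain << low x y >> = 0%R.
Proof. by apply: center_val_inj; rewrite cochainU. Qed.

Lemma cochain_apex : cochain << apex phi 2 >> = 0%R.
Proof. by apply: center_val_inj; rewrite cochainU. Qed.

Lemma cochain_high_eq x y z : cochain << high x y >> = cochain << high x z >>.
Proof. by apply: center_val_inj; rewrite !cochainU. Qed.

Lemma cochain_comm u a : F u * a = a * F u.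
Proof. exact: center_valC. Qed.

Lemma cochain_CA u a b : F u * (a * b) = a * (F u * b).
Proof. by rewrite mulgA (cochain_comm u a) -mulgA. Qed.

(** On base simplices this is associativity of s(g) s(h) s(k); on the last kind of middle simplex it
    is multiplicativity of [c]. In the remaining cases the values are trivial or cancel. *)
Lemma cochain_boundary (u : chain C 3) : cochain (boundary u) = 0%R.
Proof.
move: u; apply: freeg_subgroup_ind => [|u v u0 v0|].
- by rewrite !raddf0.
- by rewrite !raddfB /= u0 v0 subrr.
apply: simplex3P => [g h k||].
- rewrite (boundary_base3 phi) !(raddfB, raddfD) /=.
  suff: (cochain << b2 h k >> + cochain << b2 g (h * k) >> =
         cochain << b2 (g * h) k >> + cochain << b2 g h >>)%R.
    move=> /eqP; rewrite -subr_eq0 => /eqP rel; apply: eq_of_rel rel _; zmod.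
  apply: center_val_inj; rewrite !center_valD; apply: (mulIg (s g * s h * s k)).
  transitivity (s (g * h * k)).
    rewrite -!mulgA cochain_CA (cochain_CA << b2 h k >> (s g)).
    by rewrite !cochain_base.
  by rewrite -[RHS]mulgA [X in _ = _ * X]mulgA !cochain_base.
- apply: ordinal3P => x y z.
  + rewrite (boundary_mid3_0 phi) !(raddfB, raddfD) /= !cochain_low.
    rewrite cochain_apex; zmod.
  + rewrite (boundary_mid3_1 phi) !(raddfB, raddfD) /= !cochain_low.
    rewrite (cochain_high_eq x (y * z) y); zmod.
  + rewrite (boundary_mid3_2 phi) !(raddfB, raddfD) /=.
    suff: (cochain << high y z >> + cochain << high x (y * z) >> =
         cochain << high (x * y) z >> + cochain << b2 (phi x) (phi y) >>)%R.
      move=> /eqP; rewrite -subr_eq0 => /eqP rel; apply: eq_of_rel rel _; zmod.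
    apply: center_val_inj; rewrite !center_valD.
    apply: (mulIg (s (phi x) * s (phi y))).
    rewrite -[RHS]mulgA cochain_base -gmulfM cochain_high gmulfM.
    rewrite -mulgA cochain_CA (cochain_CA << high y z >> (s (phi x))).
    by rewrite cochain_high mulgA cochain_high.
- by rewrite (boundary_apex3 phi) raddf0.
Qed.

End Cochain.

(** * The normal morphism from E back to P *)

Section Retraction.
Local Open Scope group_scope.
Local Notation F u := (center_val (cochain u)).
Local Notation "[ x ]" := (@simplex_class Gam G phi x).

Definition quot_cochain : Q -> center P := coker_lift cochain.

Lemma quot_cochainE u : quot_cochain (to_coker (@boundary C 2) u) = cochain u.
Proof. exact: coker_liftE cochain_boundary u. Qed.

HB.instance Definition _ := GRing.isZmodMorphism.Build Q (center P)
  quot_cochain (coker_liftB cochain_boundary).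

Definition retraction (e : E) : P := center_val (quot_cochain e.1) * s e.2.

Lemma retractionM : {morph retraction : e e' / e * e'}.
Proof.
move=> [p g] [q h]; rewrite /retraction /=.
have [u <-] := to_coker_surj p; have [v <-] := to_coker_surj q.
rewrite !(raddfB, raddfD) /= quot_cochainE !quot_cochainE.
rewrite center_valD center_valD center_valN -[s (g * h)]cochain_base.
by rewrite -!mulgA mulKg (cochain_CA v (s g)).
Qed.
HB.instance Definition _ := isMultiplicative.Build E P retraction retractionM.

Lemma retraction_map e : nm_map P (retraction e) = e.2.
Proof.
case: e => q g; rewrite /retraction; have [u <-] := to_coker_surj q.
by rewrite gmulfM quot_cochainE cochain_ker mul1g sK.
Qed.

Lemma retraction_lift x : retraction (relative_lift phi x) = c x.
Proof.
rewrite /retraction /= /lift_coef !(raddfB, raddfD) /=.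
rewrite !quot_cochainE cochain_apex cochain_low.
by rewrite subr0 addr0 cochain_high.
Qed.

Lemma retraction_normal :
  is_normal_morphism (M1 := twisted_normal_map (base_cocycle phi)) retraction.
Proof.
split=> [e|e g]; first exact: retraction_map.
by rewrite group_morphJ -nm_NM2 retraction_map.
Qed.

End Retraction.

Section Universal.
Local Open Scope group_scope.
Local Notation F u := (center_val (cochain u)).
Local Notation "[ x ]" := (@simplex_class Gam G phi x).
Variable mu : {multiplicative P -> twisted_normal_map (base_cocycle phi)}.
Hypothesis mu_normal : is_normal_morphism mu.
Hypothesis mu_lift : forall x, mu (c x) = relative_lift phi x.

Lemma mu_map a : (mu a).2 = nm_map P a.
Proof. exact: mu_normal.1. Qed.

(** On [mid1] and the apex the values are chosen so that kappa (d u) is the class of u for [low] and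
    apex simplices u, on which F vanishes. On the base they record how [mu] moves the section. *)
Definition section_coef (x : C 1%N) : Q :=
  match x with
  | inl (inl t) => (mu (s (tnth t ord0))).1
  | inl (inr (t, _)) => (- [low 1%g (tnth t ord0)])%R
  | inr _ => [apex phi 2]
  end.

Local Notation kappa := (freeg_lift section_coef).
(** The inclusion of the central kernel Q into E, shifted because the unit of E is (b(1, 1), 1). *)
Definition fiber_incl (q : Q) : E := ((q + [b2 1%g 1%g])%R, 1).

Lemma fiber_inclD p q : fiber_incl (p + q)%R = fiber_incl p * fiber_incl q.
Proof. by congr pair; rewrite /= ?mulg1 //; zmod. Qed.

Lemma fiber_inclB p q :
  fiber_incl (p - q)%R = fiber_incl p * (fiber_incl q)^-1.
Proof. by apply: (mulIg (fiber_incl q)); rewrite mulgVK -fiber_inclD subrK. Qed.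

Lemma mu_section g : mu (s g) = (section_coef (b1 g), g) :> E.
Proof. by rewrite [LHS]surjective_pairing mu_map sK. Qed.

(** For a cycle u the correction by kappa disappears, so [mu] recovers the class of u from F u. *)
Lemma mu_cochain u :
  mu (F u) = fiber_incl (to_coker (@boundary C 2) u - kappa (boundary u))%R.
Proof.
move: u; apply: freeg_subgroup_ind => [|u v u1 v1|].
- by rewrite !raddf0 center_val0 group_morph1 addr0 /fiber_incl add0r.
- rewrite !raddfB center_valD center_valN gmulfM group_morphV u1 v1.
  rewrite -fiber_inclB; congr fiber_incl; rewrite /=; zmod.
apply: simplex2P => [g h||].
- rewrite (boundary_base2 phi) !(raddfB, raddfD) /= !freeg_liftU simplex_classE.
  apply: (mulIg (mu (s g * s h))).
  rewrite -gmulfM cochain_base gmulfM !mu_section.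
  congr pair; rewrite /= ?mul1g // base1_rel; zmod.
- apply: ordinal2P => x y.
    rewrite cochain_low center_val0 group_morph1 (boundary_low phi).
    rewrite !(raddfB, raddfD) /= !freeg_liftU simplex_classE low_rel /=.
    congr pair; rewrite /=; zmod.
  rewrite (boundary_high phi) !(raddfB, raddfD) /= !freeg_liftU simplex_classE.
  rewrite high_rel; apply: (mulIg (mu (s (phi x)))).
  rewrite -gmulfM cochain_high mu_lift mu_section.
  congr pair; rewrite /= ?mul1g // base1_rel; zmod.
- rewrite cochain_apex center_val0 group_morph1 (boundary_apex2 phi).
  by rewrite freeg_liftU simplex_classE subrr /fiber_incl add0r.
Qed.

(** * Consequences of uniqueness in the universal property *)

Hypothesis c_free : is_free_normal_closure phi c.

Lemma mu_retraction a : retraction (mu a) = a.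
Proof.
pose id_P : {multiplicative P -> P} := idfun.
pose rho : {multiplicative P -> P} :=
  (retraction : {multiplicative E -> P}) \o (mu : {multiplicative P -> E}).
have := @free_normal_closure_ext _ _ _ _ _ P rho id_P c_free.
apply=> //.
- split=> [b|b g]; first by rewrite /= retraction_normal.1 mu_normal.1.
  by rewrite /= mu_normal.2 retraction_normal.2.
- by move=> x; rewrite /= mu_lift retraction_lift.
Qed.

Lemma zero_cocycle_subproof (g h k : G) : (0 + 0 = 0 + 0 :> chain C 1%N)%R.
Proof. by []. Qed.
(** Its twisted product is the direct product C_1 x G, on which G acts trivially in the first factor
    and by conjugation in the second. *)
Definition zero_cocycle :=
  @Cocycle G (chain C 1%N) (fun _ _ => 0%R) zero_cocycle_subproof.
Local Notation Z := (twisted_product zero_cocycle).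

(* The vanishing of the defect on mu(P) is the equality of the two normal *)
(* morphisms (defect o mu, n) and (0, n) from P to C_1 x G.               *)
Definition defect_pair (a : P) : Z := (defect (mu a), nm_map P a).
Definition zero_pair (a : P) : Z := (0%R, nm_map P a).

Lemma defect_pairM : {morph defect_pair : a b / a * b}.
Proof.
move=> a b; rewrite /defect_pair !gmulfM defectM; congr pair.
by rewrite /= subr0.
Qed.
HB.instance Definition _ := isMultiplicative.Build P Z defect_pair defect_pairM.

Lemma zero_pairM : {morph zero_pair : a b / a * b}.
Proof.
move=> a b; rewrite /zero_pair !gmulfM; congr pair.
by rewrite /= subr0 addr0.
Qed.
HB.instance Definition _ := isMultiplicative.Build P Z zero_pair zero_pairM.

(** A homomorphism to an abelian group is constant on conjugacy classes; this makes [defect_pair]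
    equivariant. *)
Lemma defect_conj (a x : E) : defect (a ^ x) = defect a.
Proof.
have : defect (x * (a ^ x)) = defect (a * x) by rewrite -conjgC.
by rewrite !defectM addrC => /addIr.
Qed.

Lemma zero_act (u : chain C 1%N) g h :
  nm_act (n := twisted_normal_map zero_cocycle) (u, g) h = (u, g ^ h).
Proof. by congr pair; rewrite /= !subr0 ?oppr0 ?addr0 ?add0r. Qed.

Lemma defect_mu a : defect (mu a) = 0%R.
Proof.
suff : defect_pair a = zero_pair a by case.
apply: (@free_normal_closure_ext _ _ _ _ _ (twisted_normal_map zero_cocycle)
  defect_pair zero_pair c_free).
- split=> // b g; rewrite /defect_pair zero_act -nm_NM1; congr pair.
  by rewrite mu_normal.2; apply: defect_conj.
- by split=> // b g; rewrite /zero_pair zero_act -nm_NM1.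
- by move=> x; congr pair; rewrite mu_lift defect_lift.
Qed.

(** * The isomorphism between homology and kernel *)

Lemma homology_cochain (z : cycles C 2) :
  cochain (val (repr (\pi_(homology C 2)%qT z))) = cochain (val z).
Proof.
have /asboolP[u zu] := ideal_quot_repr (boundaries C 2) z.
have := cochain_boundary u; rewrite zu (raddfB val) raddfB => /eqP.
by rewrite subr_eq0 => /eqP.
Qed.

Definition homology_to_kernel (z : homology C 2) : kernel (nm_map P) :=
  Sub (F (val (repr z))) (introT eqP (cochain_ker _)).

Lemma homology_to_kernelD :
  {morph homology_to_kernel : z w / (z + w)%R >-> z * w}.
Proof.
move=> z w; apply: val_inj; rewrite gmulfM /= -center_valD; congr center_val.
by rewrite -{1}[z]reprK -{1}[w]reprK -raddfD homology_cochain !raddfD.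
Qed.

Lemma homology_to_kernel_inj : injective homology_to_kernel.
Proof.
move=> z w zw.
have {}zw : cochain (val (repr z)) = cochain (val (repr w)).
  exact: center_val_inj (congr1 val zw).
set d := (repr z - repr w)%R.
have d0 : cochain (val d) = 0%R.
  by rewrite (raddfB val) raddfB; apply/eqP; rewrite subr_eq0; apply/eqP.
have := mu_cochain (val d).
rewrite d0 center_val0 group_morph1 (eqP (valP d)) raddf0 subr0.
(* The unit of E now equals [fiber_incl] of the class of d, so this class is zero in Q and d
   bounds. *)
move=> /(congr1 fst) /=; rewrite -[LHS]add0r.
move=> /addIr/esym/to_coker_eq0 d_bound.
by rewrite -[z]reprK -[w]reprK; apply/eqP; rewrite ideal_quot_eq; apply/asboolP.
Qed.

Lemma homology_to_kernel_surj p : exists z, homology_to_kernel z = p.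
Proof.
case: p => a a_ker; have a1 : nm_map P a = 1 by apply/eqP.
have [u uE] := to_coker_surj (mu a).1.
(* Since [mu a] lies over 1 and has no defect, u has boundary [1], which is also the boundary of
   [b2 1 1]. *)
pose v : chain C 2 := (u - << b2 1%g 1%g >>)%R.
have v_cycle : boundary v == 0%R.
  have := defect_mu a; rewrite /defect -uE quot_boundaryE mu_map a1 => u_bound.
  rewrite /v raddfB /= (boundary_base2 phi) mulg1; apply/eqP.
  by apply: eq_of_rel u_bound _; zmod.
exists (\pi_(homology C 2)%qT (Sub v v_cycle)).
apply: val_inj; rewrite /= homology_cochain /= raddfB center_valD center_valN.
(* This turns F v into F(u) s(1), the value of [retraction] at [mu a]. *)
have <- : s 1 = (F << b2 1 1 >>)^-1.
  apply: (mulgI (F << b2 1 1 >>)); apply: (mulIg (s 1)).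
  by rewrite mulgV mul1g -mulgA cochain_base mulg1.
by rewrite -[RHS]mu_retraction /retraction -uE quot_cochainE mu_map a1.
Qed.

End Universal.

End Comparison.

Theorem theorem1p4 (Gam G : groupType) (phi : {multiplicative Gam -> G})
    (hphi : normal_closure (range phi) = [set: G]%classic)
    (P : normal_map G) (c : {multiplicative Gam -> P})
    (hP : is_free_normal_closure phi c) :
  exists h : kernel (nm_map P) -> relative_homology phi 2,
    bijective h /\ {morph h : x y / (x * y)%g >-> (x + y)%R}.
Proof.
have cP := hP.1.
have [s sK] := choice (nm_surjective cP hphi).
have [|mu [mu_n mu_c _]] :=
  hP.2 (twisted_normal_map (base_cocycle phi)) (relative_lift phi) _.
  by [].
have inj := @homology_to_kernel_inj _ _ _ _ _ cP _ sK mu mu_n mu_c.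
have surj := @homology_to_kernel_surj _ _ _ _ _ cP _ sK mu mu_n mu_c hP.
(* The required map goes out of the kernel: it is the inverse of [homology_to_kernel], and inherits
   additivity by injectivity. *)
have [h hK] := choice surj.
exists h; split.
  by exists (homology_to_kernel cP sK) => // z; apply: inj; rewrite hK.
by move=> x y; apply: inj; rewrite homology_to_kernelD !hK.
Qed.
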